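(* Let $\mathbf A=(A,\le,0,1)$ be a bounded MLUB-complete poset, $(T,R)$ a time frame with $R$ serial, $P,F,H,G$ the tense operators induced by $(T,R)$, and $\widehat G,\widehat P,\widehat H,\widehat F$ the operators on $\operatorname{DM}(\mathbf A)^T$ constructed by means of $(T,R)$. Then for all $C,D\in\mathcal P_+(A^T)$: (i) $\operatorname{Max}\widehat G(LU(C))=G(U(C))=G(\operatorname{Min}U(C))$; (ii) $\widehat P(L(D))=L(P(L(D)))=L(P(\operatorname{Max}L(D)))$; (iii) $\operatorname{Max}\widehat H(LU(C))=H(U(C))=H(\operatorname{Min}U(C))$; (iv) $\widehat F(L(D))=L(F(L(D)))=L(F(\operatorname{Max}L(D)))$.
   Context: For a poset $(A,\le)$ and $X\subseteq A$: $L(X)=\{a\mid a\le x\ \forall x\in X\}$, $U(X)=\{a\mid x\le a\ \forall x\in X\}$, $LU(X)=L(U(X))$; $\operatorname{Max}X,\operatorname{Min}X$ are the sets of maximal/minimal elements. MLUB-complete: for every nonempty $M\subseteq A$, every upper bound of $M$ lies above some minimal upper bound of $M$ and every lower bound lies below some maximal lower bound. $\mathcal P_+(X)$ = nonempty subsets of $X$. A time frame is $(T,R)$, $T\neq\emptyset$, $R\subseteq T\times T$; serial: each $s$ has some $r$ with $rRs$ and some $t$ with $sRt$. $A^T$ carries the componentwise order, and $L,U,\operatorname{Max},\operatorname{Min}$ of subsets of $A^T$ refer to it. For $B\subseteq A^T$, $B(t)=\{q(t)\mid q\in B\}$. The tense operators induced by $(T,R)$ are $P,F,H,G:\mathcal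 P_+(A^T)\to(\mathcal P_+A)^T$: $P(B)(s)=\operatorname{Min}U(\{q(t)\mid q\in B, tRs\})$, $F(B)(s)=\operatorname{Min}U(\{q(t)\mid q\in B, sRt\})$, $H(B)(s)=\operatorname{Max}L(\{q(t)\mid q\in B, tRs\})$, $G(B)(s)=\operatorname{Max}L(\{q(t)\mid q\in B, sRt\})$. Dedekind–MacNeille completion: $\operatorname{DM}(\mathbf A)=\{X\subseteq A\mid LU(X)=X\}$ ordered by inclusion; it is a complete lattice with meets given by intersection and joins $\bigvee_i X_i=LU(\bigcup_i X_i)$. For $p\in\operatorname{DM}(\mathbf A)^T$ and $s\in T$: $\widehat G(p)(s)=\bigwedge\{p(t)\mid sRt\}$, $\widehat P(p)(s)=\bigvee\{p(t)\mid tRs\}$, $\widehat H(p)(s)=\bigwedge\{p(t)\mid tRs\}$, $\widehat F(p)(s)=\bigvee\{p(t)\mid sRt\}$. Identifications: a subset of $A^T$ of the form $\prod_{t\in T}Z_t$ is identified with the function $t\mapsto Z_t$ (in particular for $C\subseteq A^T$, $L(C)=\prod_t L(C(t))$ and $LU(C)=\prod_t LU(C(t))$ are regarded as elements of $\operatorname{DM}(\mathbf A)^T$); an element $Z\in(\mathcal P_+A)^T$ is identified with $\prod_t Z(t)\subseteq A^T$ when operators are applied to it; for a function $Z$ from $T$ to subsets of $A$, $\operatorname{Max}Z$ and $L(Z)$ are taken pointwise: $(\operatorname{Max}Z)(t)=\operatorname{Max}Z(t)$, $L(Z)(t)=L(Z(t))$. *)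

(* Defs.v *)
From HB Require Import structures.
From mathcomp Require Import all_boot all_order.
From mathcomp Require Import boolp classical_sets.

Set Implicit Arguments.
Unset Strict Implicit.
Unset Printing Implicit Defensive.

Import Order.TTheory.
Local Open Scope classical_set_scope.
Local Open Scope order_scope.

Section Posets.
Context {d : Order.disp_t} {A : porderType d}.
Implicit Types X M : set A.

(* L(X) and U(X) are the library's lbound X and ubound X. *)
Definition LU X : set A := lbound (ubound X).

Definition MaxS X : set A := [set x | X x /\ forall y, X y -> x <= y -> y = x].
Definition MinS X : set A := [set x | X x /\ forall y, X y -> y <= x -> y = x].

End Posets.

Definition MLUB_complete (d : Order.disp_t) (A : porderType d) : Prop :=
  forall M : set A, M !=set0 ->
    (forall u, ubound M u -> exists2 m, MinS (ubound M) m & m <= u) /\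
    (forall l, lbound M l -> exists2 m, MaxS (lbound M) m & l <= m).

Definition serial (T : Type) (R : T -> T -> Prop) : Prop :=
  forall s, (exists r, R r s) /\ (exists t, R s t).

(* A^T is T -> A with the pointwise porderType instance of boolp (FunOrder). *)
Section TenseOperators.
Context {d : Order.disp_t} {A : porderType d} {T : Type}.
Variable R : T -> T -> Prop.
Implicit Types (B : set (T -> A)) (Z : T -> set A).

(* The operators are total on set (T -> A); on nonempty arguments their values
   are nonempty under the standing assumptions, see tense*_neq0 below. *)
Definition tenseP B : T -> set A := fun s =>
  MinS (ubound [set a | exists q t, [/\ B q, R t s & a = q t]]).
Definition tenseF B : T -> set A := fun s =>
  MinS (ubound [set a | exists q t, [/\ B q, R s t & a = q t]]).
Definition tenseH B : T -> set A := fun s =>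
  MaxS (lbound [set a | exists q t, [/\ B q, R t s & a = q t]]).
Definition tenseG B : T -> set A := fun s =>
  MaxS (lbound [set a | exists q t, [/\ B q, R s t & a = q t]]).

(* B(t) *)
Definition slice B (t : T) : set A := [set q t | q in B].

Definition prodset Z : set (T -> A) := [set q | forall t, Z t (q t)].

Definition pMax Z : T -> set A := fun t => MaxS (Z t).
Definition pL Z : T -> set A := fun t => lbound (Z t).

End TenseOperators.

Record DM (d : Order.disp_t) (A : porderType d) :=
  MkDM { DMset : set A; _ : `[< LU DMset = DMset >] }.

HB.instance Definition _ (d : Order.disp_t) (A : porderType d) :=
  [isSub for @DMset d A].
HB.instance Definition _ (d : Order.disp_t) (A : porderType d) :=
  [Choice of DM A by <:].
(* The order inherited from set A is inclusion. *)
HB.instance Definition _ (d : Order.disp_t) (A : porderType d) :=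
  [SubChoice_isSubPOrder of DM A by <: with set_display].

Section DedekindMacNeille.
Context {d : Order.disp_t} {A : porderType d}.
Implicit Types (X : set A) (p : DM A) (S : set (DM A)).

Lemma DMsetP p : LU (DMset p) = DMset p.
Proof. by case: p => X /= /asboolP. Qed.

Lemma DM_leE p q : (p <= q) = (DMset p `<=` DMset q) :> Prop.
Proof. by rewrite -subsetEset -Order.le_val. Qed.

Lemma sub_LU X : X `<=` LU X.
Proof. by move=> x Xx u; apply. Qed.

Lemma lbound_sub X Y : X `<=` Y -> lbound Y `<=` lbound X.
Proof. by move=> XY l Yl x /XY /Yl. Qed.

Lemma ubound_sub X Y : X `<=` Y -> ubound Y `<=` ubound X.
Proof. by move=> XY l Yl x /XY /Yl. Qed.

Lemma LU_sub X Y : X `<=` Y -> LU X `<=` LU Y.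
Proof. by move=> XY; apply/lbound_sub/ubound_sub. Qed.

Lemma LU_lbound X : LU (lbound X) = lbound X.
Proof.
by apply/seteqP; split; [apply: lbound_sub => x Xx l; apply|apply: sub_LU].
Qed.

Lemma LU_idem X : LU (LU X) = LU X.
Proof. exact: LU_lbound. Qed.

Lemma LU_bigcap S : LU (\bigcap_(p in S) DMset p) = \bigcap_(p in S) DMset p.
Proof.
apply/seteqP; split; last exact: sub_LU.
move=> x Sx p Sp; rewrite -DMsetP; move: x Sx; apply: LU_sub.
by move=> x; apply.
Qed.

Definition DM_of_lbound X : DM A := MkDM (asboolT (LU_lbound X)).
Definition DM_of_LU X : DM A := MkDM (asboolT (LU_idem X)).

Definition DM_meet S : DM A := MkDM (asboolT (LU_bigcap S)).
Definition DM_join S : DM A := DM_of_LU (\bigcup_(p in S) DMset p).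

Lemma DM_meetP S p : lbound S p <-> p <= DM_meet S.
Proof.
rewrite DM_leE; split => [Sp x px q /Sp|pS q Sq]; rewrite DM_leE //=.
- exact.
- by move=> x /pS; exact.
Qed.

Lemma DM_joinP S p : ubound S p <-> DM_join S <= p.
Proof.
rewrite DM_leE; split => [Sp|Sp q Sq].
- rewrite -[DMset p]DMsetP; apply: LU_sub => x [q /Sp + qx].
  by rewrite DM_leE; exact.
- by rewrite DM_leE => x qx; apply/Sp/sub_LU; exists q.
Qed.

Context {T : Type}.
Variable R : T -> T -> Prop.
Implicit Types r : T -> DM A.

Definition hatG r : T -> DM A := fun s => DM_meet [set r t | t in [set t | R s t]].
Definition hatP r : T -> DM A := fun s => DM_join [set r t | t in [set t | R t s]].
Definition hatH r : T -> DM A := fun s => DM_meet [set r t | t in [set t | R t s]].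
Definition hatF r : T -> DM A := fun s => DM_join [set r t | t in [set t | R s t]].

(* The elements of DM(A)^T identified with the subsets L(C) and LU(C) of A^T;
   prodset_DML and prodset_DMLU below justify the identification. *)
Definition DML (C : set (T -> A)) : T -> DM A := fun t => DM_of_lbound (slice C t).
Definition DMLU (C : set (T -> A)) : T -> DM A := fun t => DM_of_LU (slice C t).

(* An element of DM(A)^T seen as a function from T to subsets of A. *)
Definition DMfun r : T -> set A := fun t => DMset (r t).

End DedekindMacNeille.

Section Sanity.
Context {d : Order.disp_t} {A : tbPOrderType d} {T : Type}.
Implicit Types (B C : set (T -> A)).

Lemma prodset_DML C : prodset (DMfun (DML C)) = lbound C.
Proof.
apply/seteqP; split => q qC.
- by move=> c Cc; apply/asboolP => t; apply: qC; exists c.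
- by move=> t _ [c Cc <-]; have /asboolP := qC _ Cc; apply.
Qed.

Lemma prodset_DMLU C : prodset (DMfun (DMLU C)) = LU C.
Proof.
apply/seteqP; split => q qC.
- move=> u uC; apply/asboolP => t; apply: qC => _ [c Cc <-].
  by have /asboolP := uC _ Cc; apply.
- move=> t a at_; pose u t' := if `[< t' = t >] then a else \top.
  have uC : ubound C u.
    move=> c Cc; apply/asboolP => t'; rewrite /u; case: asboolP => [->|_].
      by apply: at_; exists c.
    exact: lex1.
  by have /asboolP/(_ t) := qC _ uC; rewrite /u; case: asboolP.
Qed.

Context (R : T -> T -> Prop) (hA : MLUB_complete A) (hR : serial R).

Lemma MinU_neq0 (X : set A) : X !=set0 -> MinS (ubound X) !=set0.
Proof.
move=> /hA[mlub _]; have [|m mX _] := mlub \top; last by exists m.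
by move=> x _; exact: lex1.
Qed.

Lemma MaxL_neq0 (X : set A) : X !=set0 -> MaxS (lbound X) !=set0.
Proof.
move=> /hA[_ mglb]; have [|m mX _] := mglb \bot; last by exists m.
by move=> x _; exact: le0x.
Qed.

Lemma tenseP_neq0 B s : B !=set0 -> tenseP R B s !=set0.
Proof.
by move=> [q Bq]; have [[t ts] _] := hR s; apply: MinU_neq0; exists (q t), q, t.
Qed.

Lemma tenseF_neq0 B s : B !=set0 -> tenseF R B s !=set0.
Proof.
by move=> [q Bq]; have [_ [t ts]] := hR s; apply: MinU_neq0; exists (q t), q, t.
Qed.

Lemma tenseH_neq0 B s : B !=set0 -> tenseH R B s !=set0.
Proof.
by move=> [q Bq]; have [[t ts] _] := hR s; apply: MaxL_neq0; exists (q t), q, t.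
Qed.

Lemma tenseG_neq0 B s : B !=set0 -> tenseG R B s !=set0.
Proof.
by move=> [q Bq]; have [_ [t ts]] := hR s; apply: MaxL_neq0; exists (q t), q, t.
Qed.

End Sanity.

(* Main.v *)
(* Bounds in A^T are taken pointwise and A is bounded, so U(C) projects onto U(C(t)) and
   L(D) onto L(D(t)); hence the pointwise cut operators and the tense operators
   are bounds of the same sets. MLUB-completeness makes every upper bound
   dominate a minimal one (pointwise, hence in A^T), so replacing a set of upper
   bounds by its minimal elements does not change its lower bounds, and dually. *)

Require Import Defs.
From HB Require Import structures.
From mathcomp Require Import all_boot all_order.
From mathcomp Require Import boolp classical_sets.
Import Order.TTheory.
Local Open Scope classical_set_scope.

(** Applied below with [X] the minimal elements of a set [Y] of upper bounds, or the values they
    take. *)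
Lemma lbound_coinitial (d : Order.disp_t) (A : porderType d) (X Y : set A) :
  X `<=` Y -> (forall y, Y y -> exists2 x, X x & (x <= y)%O) ->
  lbound X = lbound Y.
Proof.
move=> XY YX; apply/seteqP; split; last exact: lbound_sub.
by move=> l lX y /YX[x /lX lx]; exact: le_trans.
Qed.

Lemma ubound_cofinal (d : Order.disp_t) (A : porderType d) (X Y : set A) :
  X `<=` Y -> (forall y, Y y -> exists2 x, X x & (y <= x)%O) ->
  ubound X = ubound Y.
Proof.
move=> XY YX; apply/seteqP; split; last exact: ubound_sub.
by move=> l lX y /YX[x /lX lx yx]; exact: le_trans lx.
Qed.

Section PointwiseBounds.
Context {d : Order.disp_t} {A : tbPOrderType d} {T : Type}.
Implicit Types (C : set (T -> A)) (q : T -> A) (t : T).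

Lemma ubound_funE C q : ubound C q <-> forall t, ubound (slice C t) (q t).
Proof.
split=> [Cq t _ [c Cc <-]|Cq c Cc].
  by have /asboolP := Cq _ Cc; apply.
by apply/asboolP => t; apply: Cq; exists c.
Qed.

Lemma lbound_funE C q : lbound C q <-> forall t, lbound (slice C t) (q t).
Proof.
split=> [Cq t _ [c Cc <-]|Cq c Cc].
  by have /asboolP := Cq _ Cc; apply.
by apply/asboolP => t; apply: Cq; exists c.
Qed.

Lemma slice_ubound C t : slice (ubound C) t = ubound (slice C t).
Proof.
apply/seteqP; split => [_ [q /ubound_funE Cq <-]|a Ca]; first exact: Cq.
(* The default value [\top] is an upper bound of every slice, so only the coordinate [t] carries a
   constraint. *)
exists (fun t' => if `[< t' = t >] then a else \top%O); last by case: asboolP.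
apply/ubound_funE => t'; case: asboolP => [->//|_].
by move=> x _; exact: lex1.
Qed.

Lemma slice_lbound C t : slice (lbound C) t = lbound (slice C t).
Proof.
apply/seteqP; split => [_ [q /lbound_funE Cq <-]|a Ca]; first exact: Cq.
exists (fun t' => if `[< t' = t >] then a else \bot%O); last by case: asboolP.
apply/lbound_funE => t'; case: asboolP => [->//|_].
by move=> x _; exact: le0x.
Qed.

Hypothesis hA : MLUB_complete A.

(** The axiom of choice picks in each coordinate a minimal upper bound of [slice C t] below [q t]; a
    function that is minimal in every coordinate is minimal in [ubound C]. *)
Lemma MinS_ubound_fun C q : C !=set0 -> ubound C q ->
  exists2 m, MinS (ubound C) m & forall t, (m t <= q t)%O.
Proof.
move=> [c Cc] /ubound_funE Cq.
have /choice[m mP] t : exists a, MinS (ubound (slice C t)) a /\ (a <= q t)%O.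
  have [|mlub _] := hA (slice C t); first by exists (c t), c.
  by have [a ? ?] := mlub _ (Cq t); exists a.
exists m => [|t]; last by have [] := mP t.
split=> [|y /ubound_funE Cy /asboolP ym].
  by apply/ubound_funE => t; have [[]] := mP t.
by apply/funext => t; have [[_ min_m] _] := mP t; apply: min_m.
Qed.

Lemma MaxS_lbound_fun C q : C !=set0 -> lbound C q ->
  exists2 m, MaxS (lbound C) m & forall t, (q t <= m t)%O.
Proof.
move=> [c Cc] /lbound_funE Cq.
have /choice[m mP] t : exists a, MaxS (lbound (slice C t)) a /\ (q t <= a)%O.
  have [|_ mglb] := hA (slice C t); first by exists (c t), c.
  by have [a ? ?] := mglb _ (Cq t); exists a.
exists m => [|t]; last by have [] := mP t.
split=> [|y /lbound_funE Cy /asboolP ym].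
  by apply/lbound_funE => t; have [[]] := mP t.
by apply/funext => t; have [[_ max_m] _] := mP t; apply: max_m.
Qed.

(** Turns the outer [MinS] in [tenseP] and [tenseF] into the closure [LU] that defines joins of
    cuts. *)
Lemma lbound_MinS_ubound (X : set A) : X !=set0 ->
  lbound (MinS (ubound X)) = LU X.
Proof.
by move=> /hA[mlub _]; apply: lbound_coinitial => // x [].
Qed.

End PointwiseBounds.

Section TenseDM.
Context {d : Order.disp_t} {A : tbPOrderType d} {T : Type}.
Variable R : T -> T -> Prop.
Hypothesis hA : MLUB_complete A.
Implicit Types C D : set (T -> A).

(** An intersection of sets of lower bounds is the set of lower bounds of a union: both sides take
    [MaxS] of the common lower bounds of all [ubound (slice C t)] with [R s t]. *)
Lemma pMax_hatG C : pMax (DMfun (hatG R (DMLU C))) = tenseG R (ubound C).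
Proof.
apply/funext => s; congr MaxS; apply/seteqP; split => [x xC|x xC].
  move=> _ [q [t [Cq st ->]]].
  have /xC/= : [set DMLU C t | t in [set t | R s t]] (DMLU C t) by exists t.
  by apply; rewrite -slice_ubound; exists q.
move=> _ [t st <-] /= a; rewrite -slice_ubound => -[q Cq <-].
by apply: xC; exists q, t.
Qed.

Lemma tenseG_MinS C : C !=set0 ->
  tenseG R (ubound C) = tenseG R (MinS (ubound C)).
Proof.
move=> C0; apply/funext => s; congr MaxS; apply/esym/lbound_coinitial.
  by move=> _ [q [t [[Cq _] st ->]]]; exists q, t.
(* A minimal upper bound [m] of [C] below [q] supplies the smaller value [m t], taken at the same
   [t]. *)
move=> _ [q [t [Cq st ->]]]; have [m mC mq] := MinS_ubound_fun hA _ _ C0 Cq.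
by exists (m t) => //; exists m, t.
Qed.

(** Both sides are [LU] of the union of the [lbound (slice D t)] with [R s t]. Only successors are
    asked for, so that the lemma also applies to the converse of a serial relation. *)
Lemma hatF_lbound D : (forall s, exists t, R s t) ->
  DMfun (hatF R (DML D)) = pL (tenseF R (lbound D)).
Proof.
move=> serR; apply/funext => s; rewrite /pL /tenseF lbound_MinS_ubound //.
  congr LU; apply/seteqP; split => [x [_ [t st <-]] /=|_ [q [t [Dq st ->]]]].
    by rewrite -slice_lbound => -[q Dq <-]; exists q, t.
  by exists (DML D t); [exists t|rewrite /= -slice_lbound; exists q].
(* Nonemptiness of that union: the constant [\bot] lies in [lbound D], and [s] has a successor. *)
have [t st] := serR s; exists \bot%O, (fun=> \bot%O), t; split=> //.
by apply/lbound_funE => t' x _; exact: le0x.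
Qed.

Lemma tenseF_MaxS D : D !=set0 ->
  tenseF R (lbound D) = tenseF R (MaxS (lbound D)).
Proof.
move=> D0; apply/funext => s; congr MinS; apply/esym/ubound_cofinal.
  by move=> _ [q [t [[Dq _] st ->]]]; exists q, t.
move=> _ [q [t [Dq st ->]]]; have [m mD mq] := MaxS_lbound_fun hA _ _ D0 Dq.
by exists (m t) => //; exists m, t.
Qed.

End TenseDM.

Theorem theorem4p1 (d : Order.disp_t) (A : tbPOrderType d) (T : Type)
    (R : T -> T -> Prop) (hA : MLUB_complete A) (hT : inhabited T)
    (hR : serial R) (C D : set (T -> A)) (hC : C !=set0) (hD : D !=set0) :
  [/\ pMax (DMfun (hatG R (DMLU C))) = tenseG R (ubound C) /\
        tenseG R (ubound C) = tenseG R (MinS (ubound C)),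
      DMfun (hatP R (DML D)) = pL (tenseP R (lbound D)) /\
        pL (tenseP R (lbound D)) = pL (tenseP R (MaxS (lbound D))),
      pMax (DMfun (hatH R (DMLU C))) = tenseH R (ubound C) /\
        tenseH R (ubound C) = tenseH R (MinS (ubound C))
    & DMfun (hatF R (DML D)) = pL (tenseF R (lbound D)) /\
        pL (tenseF R (lbound D)) = pL (tenseF R (MaxS (lbound D)))].
Proof.
(* P and H are F and G of the converse relation, definitionally. *)
pose Rc s t := R t s.
split; split.
- exact: pMax_hatG.
- exact: tenseG_MinS.
- by apply: (hatF_lbound Rc hA) => s; have [] := hR s.
- by congr pL; exact: (tenseF_MaxS Rc hA).
- exact: (pMax_hatG Rc).
- exact: (tenseG_MinS Rc hA).
- by apply: hatF_lbound => // s; have [] := hR s.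
- by congr pL; exact: tenseF_MaxS.
Qed.
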